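(* Fix $(\alpha_0,u_0,T_0)$ with $0<\alpha_0<1$, $u_0\in\mathbb R$, $T_0>0$, and fix $u\in\mathbb R$ with $u\ne u_0$. Then there exists a unique point $(\alpha,T)$ with $\alpha\in(\alpha_0,1)$, $T>0$, such that $(\alpha,u,T)$ belongs to the Hugoniot locus of $(\alpha_0,u_0,T_0)$.
   Context: Fix positive constants $a^2$, $T_{\rm i}$, $\kappa$. For an ionized gas with degree of ionization $\alpha\in(0,1)$ and temperature $T>0$, put $p=\frac1\kappa\frac{1-\alpha^2}{\alpha^2}T^{5/2}e^{-T_{\rm i}/T}$ (pressure), $v=a^2(1+\alpha)T/p$ (specific volume), $e=a^2\left[\frac32(1+\alpha)T+T_{\rm i}\alpha\right]$ (internal energy). Let $p_0,v_0,e_0$ be the values at $(\alpha_0,T_0)$. The Hugoniot locus of $(\alpha_0,u_0,T_0)$ is the set of $(\alpha,u,T)$ satisfying both $$(u-u_0)^2+(p-p_0)(v-v_0)=0\quad\text{(kinetic part)},\qquad e-e_0+\tfrac12(p+p_0)(v-v_0)=0\quad\text{(thermodynamic part)}.$$ *)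

(* Defs.v *)
From Stdlib Require Import Reals.

Open Scope R_scope.

Set Implicit Arguments.

(* Physical constants of the gas, in the same order throughout: [a] enters only
   through [a ^ 2], [Ti] is the ionization temperature, [kappa] the constant in
   Saha's law. *)

(* [Rpower T (5 / 2)] is the real power T^{5/2} for T > 0. *)
Definition pressure (Ti kappa alpha T : R) : R :=
  1 / kappa * ((1 - alpha ^ 2) / alpha ^ 2) * Rpower T (5 / 2) * exp (- Ti / T).

Definition specific_volume (a Ti kappa alpha T : R) : R :=
  a ^ 2 * (1 + alpha) * T / pressure Ti kappa alpha T.

Definition internal_energy (a Ti alpha T : R) : R :=
  a ^ 2 * (3 / 2 * (1 + alpha) * T + Ti * alpha).

(* States are triples (alpha, u, T); the physical range 0 < alpha < 1, 0 < T is
   required where the predicates are used. *)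
Definition kinetic_part (a Ti kappa alpha0 u0 T0 alpha u T : R) : Prop :=
  (u - u0) ^ 2
  + (pressure Ti kappa alpha T - pressure Ti kappa alpha0 T0)
    * (specific_volume a Ti kappa alpha T
       - specific_volume a Ti kappa alpha0 T0) = 0.

Definition thermodynamic_part (a Ti kappa alpha0 T0 alpha T : R) : Prop :=
  internal_energy a Ti alpha T - internal_energy a Ti alpha0 T0
  + 1 / 2 * (pressure Ti kappa alpha T + pressure Ti kappa alpha0 T0)
    * (specific_volume a Ti kappa alpha T
       - specific_volume a Ti kappa alpha0 T0) = 0.

Definition hugoniot_locus (a Ti kappa alpha0 u0 T0 alpha u T : R) : Prop :=
  kinetic_part a Ti kappa alpha0 u0 T0 alpha u T
  /\ thermodynamic_part a Ti kappa alpha0 T0 alpha T.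

(* Main.v *)
Require Import Defs.
From Stdlib Require Import Reals.
From Stdlib Require Import Lra Ranalysis5.

Open Scope R_scope.

(** Write [w = (1 + alpha) * T], so that [p v = a^2 w], put
    [y = p / p0 - 1] for the relative overpressure and
    [K = (u - u0)^2 / a^2 > 0].  After division by [a^2] the two parts of the
    Hugoniot locus involve only [w], [alpha] and [y]:
      - kinetic: [y (w0 - w / (1 + y)) = K],
      - thermodynamic:
        [4 (w - w0) + w / (1 + y) - w0 (1 + y) + 2 Ti (alpha - alpha0) = 0].
    The first is linear in [w] and the second is then linear in [alpha], so
    for [y > 0] they define an explicit rational curve ([shock_curve_iff])
      [w = (1 + y) (w0 - K / y)],
      [alpha = alpha0 + (5 K / y + 4 K - 3 w0 y) / (2 Ti)],
    along which [w] increases and [alpha] decreases.  What remains is one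
    scalar equation in [y]: the definition of the pressure, that is Saha's law
      [kappa p0 (1 + y) alpha^2 = (1 - alpha^2) S(T)],
      [S(T) = T^(5/2) exp (- Ti / T)].

    _Uniqueness_ ([saha_curve_unique]).  Dividing Saha's law by
    [(1 + y) (1 + alpha)] turns it into
      [kappa p0 alpha^2 = (1 - alpha) (w0 - K / y) (S(T) / T)].
    As [y] grows the left side decreases, while every factor on the right
    increases, because [T = w / (1 + alpha)] and
    [S(T) / T = T^(3/2) exp (- Ti / T)] do.

    _Existence_ ([saha_curve_exists]) is the intermediate value theorem on a
    segment of the curve.  At its upper end [alpha = alpha0], and the jump is
    that of a monatomic gas, with temperature ratio
    [h(x) = x (4 + x) / (4 x + 1)] at pressure ratio [x = 1 + y].  The
    entropy of such a gas increases across a compressive shock, i.e.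
    [h(x)^(5/2) > x], so [S(T)] exceeds the value which Saha's law requires.
    Near the value [y = K / w0], where [T] vanishes, [S(T)] is too small.

    _No other branch_ ([ionizing_jump_compressive]).  The case [y = 0] is
    excluded by [K > 0].  If [y < 0], then
    [alpha > alpha0] forces [T < T0 h(x)] with [x < 1], and the entropy
    inequality [h(x)^(5/2) < x] makes [S(T)] too small for the ionization to
    have increased. *)

(** * The temperature factor in Saha's law *)

Definition saha_factor (Ti T : R) : R := Rpower T (5 / 2) * exp (- Ti / T).

Lemma saha_factor_pos (Ti T : R) : 0 < saha_factor Ti T.
Proof.
  apply Rmult_lt_0_compat; [apply exp_pos | apply exp_pos].
Qed.

Lemma arrhenius_increasing (Ti s t : R) :
  0 < Ti -> 0 < s -> s < t -> exp (- Ti / s) < exp (- Ti / t).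
Proof.
  intros HTi Hs Hst. apply exp_increasing.
  assert (/ t < / s) by (apply Rinv_lt_contravar; nra).
  unfold Rdiv; nra.
Qed.

Lemma arrhenius_lt_1 (Ti t : R) : 0 < Ti -> 0 < t -> exp (- Ti / t) < 1.
Proof.
  intros HTi Ht. rewrite <- exp_0. apply exp_increasing.
  assert (0 < / t) by (now apply Rinv_0_lt_compat).
  unfold Rdiv; nra.
Qed.

(** Splitting off one power of [T] leaves a factor that is still increasing;
    this is what makes the uniqueness argument monotone. *)
Lemma saha_factor_div (Ti T : R) :
  0 < T -> saha_factor Ti T = T * (Rpower T (3 / 2) * exp (- Ti / T)).
Proof.
  intros HT. unfold saha_factor.
  replace (5 / 2) with (1 + 3 / 2) by lra.
  rewrite Rpower_plus, Rpower_1 by assumption. ring.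
Qed.

Lemma Rpower_lt_base (x y c : R) :
  0 < c -> 0 < x -> x < y -> Rpower x c < Rpower y c.
Proof.
  intros Hc Hx Hxy. apply Rlt_Rpower_l; lra.
Qed.

Lemma saha_factor_continuous (Ti T : R) :
  0 < T -> continuity_pt (saha_factor Ti) T.
Proof.
  intros HT. apply derivable_continuous_pt.
  apply derivable_pt_mult.
  - exists (5 / 2 * Rpower T (5 / 2 - 1)). now apply derivable_pt_lim_power.
  - reg. lra.
Qed.

(** The exponential is below 1, so it suffices that [T^(5/2) <= c]; this gives
    the explicit threshold [c^(2/5)]. *)
Lemma saha_factor_small (Ti T c : R) :
  0 < Ti -> 0 < c -> 0 < T -> T <= Rpower c (2 / 5) -> saha_factor Ti T < c.
Proof.
  intros HTi Hc HT HTc.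
  pose proof (arrhenius_lt_1 Ti T HTi HT) as He.
  assert (Hp : Rpower T (5 / 2) <= c).
  { replace c with (Rpower (Rpower c (2 / 5)) (5 / 2)).
    - apply Rle_Rpower_l; lra.
    - rewrite Rpower_mult. replace (2 / 5 * (5 / 2)) with 1 by lra.
      now apply Rpower_1. }
  assert (0 < Rpower T (5 / 2)) by apply exp_pos.
  unfold saha_factor. nra.
Qed.

(** * Entropy inequality for the monatomic shock *)

(** The Hugoniot temperature ratio of an ideal gas with adiabatic exponent
    5/3, as a function of the pressure ratio [x]; it governs the jump when the
    degree of ionization does not change. *)
Definition monatomic_jump (x : R) : R := x * (4 + x) / (4 * x + 1).

Lemma Rpower_5_2_sqr (x : R) :
  0 < x -> Rpower x (5 / 2) * Rpower x (5 / 2) = x ^ 5.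
Proof.
  intros Hx. rewrite <- Rpower_plus, <- Rpower_pow by assumption.
  f_equal. simpl. lra.
Qed.

Lemma monatomic_jump_pos (x : R) : 0 < x -> 0 < monatomic_jump x.
Proof.
  intros Hx. unfold monatomic_jump. apply Rdiv_lt_0_compat; nra.
Qed.

(** The triple zero at [x = 1] reflects that the Hugoniot curve and the
    isentrope agree there up to second order; the cofactor has positive coefficients,
    so the sign on each side of 1 can be read off. *)
Lemma monatomic_jump_pow5 (x : R) :
  0 < x ->
  x ^ 2 - monatomic_jump x ^ 5
  = x ^ 2 * (1 - x) ^ 3
    * (1 + 23 * x + 226 * x ^ 2 + 226 * x ^ 3 + 23 * x ^ 4 + x ^ 5)
    / (4 * x + 1) ^ 5.
Proof.
  intros Hx. unfold monatomic_jump. field. lra.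
Qed.

Lemma monatomic_jump_factor_pos (x : R) :
  0 < x ->
  0 < x ^ 2
      * (1 + 23 * x + 226 * x ^ 2 + 226 * x ^ 3 + 23 * x ^ 4 + x ^ 5)
      / (4 * x + 1) ^ 5.
Proof.
  intros Hx.
  assert (0 < x ^ 2) by now apply pow_lt.
  assert (0 < x ^ 3) by now apply pow_lt.
  assert (0 < x ^ 4) by now apply pow_lt.
  assert (0 < x ^ 5) by now apply pow_lt.
  apply Rdiv_lt_0_compat; [ | apply pow_lt; lra].
  apply Rmult_lt_0_compat; lra.
Qed.

(** Squaring replaces the exponent 5/2 by a polynomial comparison of [h(x)^5]
    with [x^2], decided by [monatomic_jump_pow5]. *)
Lemma monatomic_jump_rarefaction (x : R) :
  0 < x < 1 -> Rpower (monatomic_jump x) (5 / 2) < x.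
Proof.
  intros [Hx Hx1].
  pose proof (monatomic_jump_pow5 x Hx) as E.
  pose proof (monatomic_jump_factor_pos x Hx) as P.
  pose proof (Rpower_5_2_sqr _ (monatomic_jump_pos x Hx)) as Q.
  assert (0 < Rpower (monatomic_jump x) (5 / 2)) by apply exp_pos.
  assert (0 < (1 - x) ^ 3) by (apply pow_lt; lra).
  assert (0 < x ^ 2 - monatomic_jump x ^ 5).
  { rewrite E. eapply Rlt_le_trans; [exact (Rmult_lt_0_compat _ _ H0 P) | ].
    right. unfold Rdiv. ring. }
  nra.
Qed.

Lemma monatomic_jump_compression (x : R) :
  1 < x -> x < Rpower (monatomic_jump x) (5 / 2).
Proof.
  intros Hx1. assert (Hx : 0 < x) by lra.
  pose proof (monatomic_jump_pow5 x Hx) as E.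
  pose proof (monatomic_jump_factor_pos x Hx) as P.
  pose proof (Rpower_5_2_sqr _ (monatomic_jump_pos x Hx)) as Q.
  assert (0 < Rpower (monatomic_jump x) (5 / 2)) by apply exp_pos.
  assert (0 < (x - 1) ^ 3) by (apply pow_lt; lra).
  assert (0 < monatomic_jump x ^ 5 - x ^ 2).
  { replace (monatomic_jump x ^ 5 - x ^ 2)
      with (- (x ^ 2 - monatomic_jump x ^ 5)) by ring.
    rewrite E. eapply Rlt_le_trans; [exact (Rmult_lt_0_compat _ _ H0 P) | ].
    right. unfold Rdiv. ring. }
  nra.
Qed.

(** The power of the temperature already loses the factor [x], by the entropy
    inequality, and the exponential only decreases further because
    [T < T0]. *)
Lemma saha_rarefaction (Ti T0 T x : R) :
  0 < Ti -> 0 < T0 -> 0 < x < 1 -> 0 < T -> T < T0 * monatomic_jump x ->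
  saha_factor Ti T < x * saha_factor Ti T0.
Proof.
  intros HTi HT0 Hx HT Hlt.
  assert (Hj : 0 < monatomic_jump x) by (apply monatomic_jump_pos; lra).
  assert (Hj1 : monatomic_jump x < 1).
  { unfold monatomic_jump. apply Rmult_lt_reg_r with (4 * x + 1); [lra | ].
    unfold Rdiv. rewrite Rmult_assoc, Rinv_l by lra. nra. }
  assert (HTT : T < T0) by nra.
  pose proof (arrhenius_increasing Ti T T0 HTi HT HTT) as He.
  pose proof (monatomic_jump_rarefaction x Hx) as Hr.
  assert (Hp : Rpower T (5 / 2) < Rpower T0 (5 / 2) * x).
  { apply Rlt_trans with (Rpower (T0 * monatomic_jump x) (5 / 2)).
    - apply Rpower_lt_base; lra.
    - rewrite <- Rpower_mult_distr by assumption.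
      apply Rmult_lt_compat_l; [apply exp_pos | assumption]. }
  unfold saha_factor.
  replace (x * (Rpower T0 (5 / 2) * exp (- Ti / T0)))
    with (Rpower T0 (5 / 2) * x * exp (- Ti / T0)) by ring.
  apply Rmult_gt_0_lt_compat; try assumption; try apply exp_pos.
  apply Rlt_trans with (2 := Hp). apply exp_pos.
Qed.

Lemma saha_compression (Ti T0 x : R) :
  0 < Ti -> 0 < T0 -> 1 < x ->
  x * saha_factor Ti T0 < saha_factor Ti (T0 * monatomic_jump x).
Proof.
  intros HTi HT0 Hx.
  assert (Hj : 0 < monatomic_jump x) by (apply monatomic_jump_pos; lra).
  assert (Hj1 : 1 < monatomic_jump x).
  { unfold monatomic_jump. apply Rmult_lt_reg_r with (4 * x + 1); [lra | ].
    unfold Rdiv. rewrite Rmult_assoc, Rinv_l by lra. nra. }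
  assert (HTT : T0 < T0 * monatomic_jump x) by nra.
  pose proof (arrhenius_increasing Ti _ _ HTi HT0 HTT) as He.
  pose proof (monatomic_jump_compression x Hx) as Hr.
  unfold saha_factor. rewrite <- Rpower_mult_distr by assumption.
  replace (x * (Rpower T0 (5 / 2) * exp (- Ti / T0)))
    with (Rpower T0 (5 / 2) * x * exp (- Ti / T0)) by ring.
  assert (0 < Rpower T0 (5 / 2)) by apply exp_pos.
  apply Rmult_gt_0_lt_compat; try assumption; try apply exp_pos.
  - repeat apply Rmult_lt_0_compat; try assumption. apply exp_pos.
  - now apply Rmult_lt_compat_l.
Qed.

(** * Reduction to a curve parametrized by the overpressure *)

Definition shock_w (K w0 y : R) : R := (1 + y) * (w0 - K / y).

Definition shock_alpha (K w0 Ti alpha0 y : R) : R :=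
  alpha0 + (5 * K / y + 4 * K - 3 * w0 * y) / (2 * Ti).

Lemma pressure_pos (Ti kappa alpha T : R) :
  0 < kappa -> 0 < alpha < 1 -> 0 < pressure Ti kappa alpha T.
Proof.
  intros Hk Ha. unfold pressure.
  repeat apply Rmult_lt_0_compat; try apply exp_pos; try lra;
    try (apply Rinv_0_lt_compat; nra).
  nra.
Qed.

Lemma pressure_eq_iff (Ti kappa alpha T p : R) :
  0 < kappa -> 0 < alpha ->
  pressure Ti kappa alpha T = p <->
  kappa * p * alpha ^ 2 = (1 - alpha ^ 2) * saha_factor Ti T.
Proof.
  intros Hk Ha.
  assert (E : pressure Ti kappa alpha T
          = (1 - alpha ^ 2) * saha_factor Ti T / (kappa * alpha ^ 2))
    by (unfold pressure, saha_factor; field; lra).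
  rewrite E. split.
  - intros <-. field. lra.
  - intros <-. field. lra.
Qed.

(** Since [p v = a^2 w] at both states, the products [p0 v] and [p v0] are
    [a^2 w / (1 + y)] and [a^2 w0 (1 + y)]; the constants [a^2] and [p0] drop
    out of both equations. *)
Lemma hugoniot_locus_normalized (a Ti kappa alpha0 u0 T0 alpha u T y : R) :
  0 < a ^ 2 -> 0 < 1 + y -> 0 < pressure Ti kappa alpha0 T0 ->
  pressure Ti kappa alpha T = pressure Ti kappa alpha0 T0 * (1 + y) ->
  hugoniot_locus a Ti kappa alpha0 u0 T0 alpha u T <->
  y * ((1 + alpha0) * T0 - (1 + alpha) * T / (1 + y)) = (u - u0) ^ 2 / a ^ 2
  /\ 4 * ((1 + alpha) * T - (1 + alpha0) * T0)
     + (1 + alpha) * T / (1 + y) - (1 + alpha0) * T0 * (1 + y)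
     + 2 * Ti * (alpha - alpha0) = 0.
Proof.
  intros Ha Hy Hp0 Hp.
  unfold hugoniot_locus, kinetic_part, thermodynamic_part,
    specific_volume, internal_energy.
  rewrite Hp. set (p0 := pressure Ti kappa alpha0 T0) in *. clearbody p0.
  set (A := a ^ 2) in *. clearbody A.
  set (w := (1 + alpha) * T). set (w0 := (1 + alpha0) * T0).
  set (U := (u - u0) ^ 2).
  assert (EK : U + (p0 * (1 + y) - p0)
      * (A * (1 + alpha) * T / (p0 * (1 + y)) - A * (1 + alpha0) * T0 / p0)
      = A * (U / A - y * (w0 - w / (1 + y))))
    by (unfold w, w0; field; lra).
  assert (ET : A * (3 / 2 * (1 + alpha) * T + Ti * alpha)
      - A * (3 / 2 * (1 + alpha0) * T0 + Ti * alpha0)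
      + 1 / 2 * (p0 * (1 + y) + p0)
        * (A * (1 + alpha) * T / (p0 * (1 + y)) - A * (1 + alpha0) * T0 / p0)
      = A / 2 * (4 * (w - w0) + w / (1 + y) - w0 * (1 + y)
                 + 2 * Ti * (alpha - alpha0)))
    by (unfold w, w0; field; lra).
  rewrite EK, ET.
  split; intros [H1 H2]; split.
  - apply Rmult_integral in H1. lra.
  - apply Rmult_integral in H2. lra.
  - rewrite H1. ring.
  - rewrite H2. ring.
Qed.

Lemma shock_curve_iff (K w0 Ti alpha0 w alpha y : R) :
  0 < Ti -> 0 < y ->
  (y * (w0 - w / (1 + y)) = K
   /\ 4 * (w - w0) + w / (1 + y) - w0 * (1 + y) + 2 * Ti * (alpha - alpha0) = 0)
  <-> w = shock_w K w0 y /\ alpha = shock_alpha K w0 Ti alpha0 y.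
Proof.
  intros HTi Hy. unfold shock_w, shock_alpha. split.
  - intros [HK HT].
    assert (Hw : w = (1 + y) * (w0 - K / y)) by (rewrite <- HK; field; lra).
    split; [exact Hw | ].
    apply Rmult_eq_reg_l with (2 * Ti); [ | lra].
    replace (2 * Ti * alpha)
      with (2 * Ti * alpha0 - (4 * (w - w0) + w / (1 + y) - w0 * (1 + y)))
      by lra.
    rewrite Hw. field. lra.
  - intros [-> ->]. split; field; lra.
Qed.

Lemma shock_w_increasing (K w0 y z : R) :
  0 < K -> 0 < w0 -> 0 < y -> y < z -> shock_w K w0 y < shock_w K w0 z.
Proof.
  intros HK Hw Hy Hyz. unfold shock_w.
  assert (/ z < / y) by (apply Rinv_lt_contravar; nra).
  assert (y * / y = 1) by (apply Rinv_r; lra).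
  assert (z * / z = 1) by (apply Rinv_r; lra).
  unfold Rdiv. nra.
Qed.

Lemma shock_alpha_decreasing (K w0 Ti alpha0 y z : R) :
  0 < K -> 0 < w0 -> 0 < Ti -> 0 < y -> y < z ->
  shock_alpha K w0 Ti alpha0 z < shock_alpha K w0 Ti alpha0 y.
Proof.
  intros HK Hw HTi Hy Hyz. unfold shock_alpha.
  assert (/ z < / y) by (apply Rinv_lt_contravar; nra).
  apply Rplus_lt_compat_l. apply Rmult_lt_compat_r.
  - apply Rinv_0_lt_compat. lra.
  - unfold Rdiv. nra.
Qed.

(** Solving the thermodynamic equation for [w] gives
    [w = w0 h(x) - 2 Ti (alpha - alpha0) x / (4 x + 1)] with [x = 1 + y], hence
    [T < T0 h(x)].  If [x < 1], then [saha_rarefaction] contradicts the lower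
    bound on [S(T)], which is the form in which Saha's law and
    [alpha > alpha0] enter. *)
Lemma ionizing_jump_compressive (Ti alpha0 T0 alpha T w0 K y : R) :
  0 < Ti -> 0 < T0 -> 0 < alpha0 -> alpha0 < alpha < 1 -> 0 < T -> 0 < K ->
  0 < 1 + y -> w0 = (1 + alpha0) * T0 ->
  saha_factor Ti T0 * (1 + y) < saha_factor Ti T ->
  y * (w0 - (1 + alpha) * T / (1 + y)) = K ->
  4 * ((1 + alpha) * T - w0) + (1 + alpha) * T / (1 + y) - w0 * (1 + y)
     + 2 * Ti * (alpha - alpha0) = 0 ->
  0 < y.
Proof.
  intros HTi HT0 Ha0 Ha HT HK Hy Hw0 HS Hkin Hth.
  destruct (Rlt_or_le 0 y) as [ | Hle]; [assumption | exfalso].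
  assert (Hneg : y < 0).
  { destruct (Req_dec y 0) as [E | ]; [rewrite E in Hkin | ]; lra. }
  assert (Hj : T < T0 * monatomic_jump (1 + y)).
  { assert (Ew : (1 + alpha) * T
       = w0 * monatomic_jump (1 + y)
         - 2 * Ti * (alpha - alpha0) * (1 + y) / (4 * (1 + y) + 1)).
    { apply Rmult_eq_reg_r with ((4 * (1 + y) + 1) / (1 + y)).
      - unfold monatomic_jump.
        replace ((1 + alpha) * T * ((4 * (1 + y) + 1) / (1 + y)))
          with (4 * ((1 + alpha) * T) + (1 + alpha) * T / (1 + y))
          by (field; lra).
        replace (4 * ((1 + alpha) * T) + (1 + alpha) * T / (1 + y))
          with (4 * w0 + w0 * (1 + y) - 2 * Ti * (alpha - alpha0)) by lra.
        field. lra.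
      - apply Rgt_not_eq, Rdiv_lt_0_compat; lra. }
    assert (0 < 2 * Ti * (alpha - alpha0) * (1 + y) / (4 * (1 + y) + 1)).
    { apply Rdiv_lt_0_compat; [ | lra].
      repeat apply Rmult_lt_0_compat; lra. }
    assert ((1 + alpha0) * T < (1 + alpha) * T) by nra.
    apply Rmult_lt_reg_l with (1 + alpha0); [lra | ].
    rewrite Hw0 in Ew. lra. }
  assert (Hx : 0 < 1 + y < 1) by lra.
  pose proof (saha_rarefaction Ti T0 T (1 + y) HTi HT0 Hx HT Hj).
  lra.
Qed.

(** * Uniqueness *)

(** The case [y < z] of two solutions: Saha's law is written as
    [c alpha^2 = (1 - alpha) (w0 - K / y) (S(T) / T)], whose sides move in
    opposite directions along the curve. *)
Lemma saha_curve_unique (Ti K w0 alpha0 c y z alphay alphaz Ty Tz : R) :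
  0 < Ti -> 0 < K -> 0 < w0 -> 0 < c ->
  0 < y -> y < z ->
  0 < alphay < 1 -> 0 < alphaz < 1 -> 0 < Ty -> 0 < Tz ->
  alphay = shock_alpha K w0 Ti alpha0 y ->
  alphaz = shock_alpha K w0 Ti alpha0 z ->
  (1 + alphay) * Ty = shock_w K w0 y -> (1 + alphaz) * Tz = shock_w K w0 z ->
  c * (1 + y) * alphay ^ 2 = (1 - alphay ^ 2) * saha_factor Ti Ty ->
  c * (1 + z) * alphaz ^ 2 = (1 - alphaz ^ 2) * saha_factor Ti Tz ->
  False.
Proof.
  intros HTi HK Hw0 Hc Hy Hyz Hay Haz HTy HTz Ey Ez Wy Wz Sy Sz.
  assert (Ha : alphaz < alphay)
    by (rewrite Ey, Ez; now apply shock_alpha_decreasing).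
  pose proof (shock_w_increasing K w0 y z HK Hw0 Hy Hyz) as Hw.
  assert (HT : Ty < Tz) by nra.
  rewrite saha_factor_div in Sy, Sz by assumption.
  set (sy := Rpower Ty (3 / 2) * exp (- Ti / Ty)) in *.
  set (sz := Rpower Tz (3 / 2) * exp (- Ti / Tz)) in *.
  assert (Hsy : 0 < sy) by (apply Rmult_lt_0_compat; apply exp_pos).
  assert (Hs : sy < sz).
  { apply Rmult_gt_0_lt_compat; try apply exp_pos.
    - apply Rpower_lt_base; lra.
    - now apply arrhenius_increasing. }
  clearbody sy sz.
  assert (Qy : c * alphay ^ 2 = (1 - alphay) * (w0 - K / y) * sy).
  { apply Rmult_eq_reg_l with (1 + y); [ | lra].
    transitivity ((1 - alphay ^ 2) * (Ty * sy)); [lra | ].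
    transitivity ((1 - alphay) * ((1 + alphay) * Ty) * sy); [ring | ].
    rewrite Wy. unfold shock_w. ring. }
  assert (Qz : c * alphaz ^ 2 = (1 - alphaz) * (w0 - K / z) * sz).
  { apply Rmult_eq_reg_l with (1 + z); [ | lra].
    transitivity ((1 - alphaz ^ 2) * (Tz * sz)); [lra | ].
    transitivity ((1 - alphaz) * ((1 + alphaz) * Tz) * sz); [ring | ].
    rewrite Wz. unfold shock_w. ring. }
  assert (Hv : w0 - K / y < w0 - K / z).
  { assert (/ z < / y) by (apply Rinv_lt_contravar; nra). unfold Rdiv. nra. }
  assert (Hvy : 0 < w0 - K / y).
  { assert (0 < shock_w K w0 y) by (rewrite <- Wy; nra).
    unfold shock_w in *. nra. }
  assert (L : c * alphaz ^ 2 < c * alphay ^ 2)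
    by (apply Rmult_lt_compat_l; nra).
  rewrite Qy, Qz in L.
  assert (M : (1 - alphay) * (w0 - K / y) * sy
              < (1 - alphaz) * (w0 - K / z) * sz).
  { apply Rmult_gt_0_lt_compat; try assumption.
    - apply Rmult_lt_0_compat; lra.
    - apply Rmult_gt_0_lt_compat; lra. }
  lra.
Qed.

(** * Existence *)

(** The parameter of the curve at which [alpha = alpha0]; it lies in the range
    [y > K / w0] where the temperature is positive. *)
Lemma frozen_ionization_shock (K w0 : R) :
  0 < K -> 0 < w0 ->
  exists y, K / w0 < y /\ 5 * K / y + 4 * K - 3 * w0 * y = 0.
Proof.
  intros HK Hw0.
  set (D := 4 * K ^ 2 + 15 * w0 * K).
  assert (HD : 0 < D) by (unfold D; nra).
  pose proof (sqrt_lt_R0 D HD) as Hs.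
  pose proof (sqrt_sqrt D (Rlt_le _ _ HD)) as Hq.
  assert (HsK : 2 * K < sqrt D) by (unfold D in *; nra).
  exists ((2 * K + sqrt D) / (3 * w0)).
  split.
  - apply Rmult_lt_reg_r with (3 * w0); [lra | ].
    replace (K / w0 * (3 * w0)) with (3 * K) by (field; lra).
    replace ((2 * K + sqrt D) / (3 * w0) * (3 * w0))
      with (2 * K + sqrt D) by (field; lra).
    lra.
  - replace (5 * K / ((2 * K + sqrt D) / (3 * w0)) + 4 * K
             - 3 * w0 * ((2 * K + sqrt D) / (3 * w0)))
      with ((15 * w0 * K + 4 * K ^ 2 - sqrt D * sqrt D) / (2 * K + sqrt D))
      by (field; lra).
    rewrite Hq. unfold D. field. fold D. lra.
Qed.

(** [shock_w] vanishes at [K / w0]; the point sought is [K / w0 + h], where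
    [w = w0 h (1 + 1 / y) <= h (w0 + w0^2 / K)]. *)
Lemma shock_w_small (K w0 ymax eps : R) :
  0 < K -> 0 < w0 -> 0 < eps -> K / w0 < ymax ->
  exists y, K / w0 < y < ymax /\ shock_w K w0 y <= eps.
Proof.
  intros HK Hw0 He Hm.
  assert (Hk : 0 < K / w0) by now apply Rdiv_lt_0_compat.
  set (h := Rmin ((ymax - K / w0) / 2) (eps / (w0 + w0 * (w0 / K)))).
  assert (Hwk : 0 < w0 / K) by now apply Rdiv_lt_0_compat.
  assert (Hd : 0 < w0 + w0 * (w0 / K)) by nra.
  assert (Hh : 0 < h).
  { apply Rmin_glb_lt; [lra | now apply Rdiv_lt_0_compat]. }
  assert (Hh1 : h <= (ymax - K / w0) / 2) by apply Rmin_l.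
  assert (Hh2 : h * (w0 + w0 * (w0 / K)) <= eps).
  { apply Rle_trans with (eps / (w0 + w0 * (w0 / K)) * (w0 + w0 * (w0 / K))).
    - apply Rmult_le_compat_r; [lra | apply Rmin_r].
    - right. field. repeat split; nra. }
  exists (K / w0 + h). split; [lra | ].
  set (y := K / w0 + h) in *.
  assert (Hy : K / w0 < y) by (unfold y; lra).
  assert (E : shock_w K w0 y = w0 * h + w0 * h * / y).
  { replace h with (y - K / w0) by (unfold y; ring).
    unfold shock_w. field. lra. }
  rewrite E.
  assert (/ y <= w0 / K).
  { replace (w0 / K) with (/ (K / w0)) by (field; lra).
    apply Rinv_le_contravar; lra. }
  assert (0 < w0 * h) by nra.
  nra.
Qed.

(** The bound [alpha < 1] is not imposed on the segment: there [alpha] may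
    exceed 1, and then the right side of Saha's law is negative, which only
    helps at the lower end.  At a root the left side is positive, so
    [alpha < 1] holds automatically. *)
Lemma saha_curve_exists (Ti T0 alpha0 w0 K c : R) :
  0 < Ti -> 0 < T0 -> 0 < alpha0 < 1 -> 0 < K -> 0 < c ->
  w0 = (1 + alpha0) * T0 ->
  c * alpha0 ^ 2 = (1 - alpha0 ^ 2) * saha_factor Ti T0 ->
  exists y alpha T,
    0 < y /\ alpha0 < alpha < 1 /\ 0 < T
    /\ alpha = shock_alpha K w0 Ti alpha0 y
    /\ (1 + alpha) * T = shock_w K w0 y
    /\ c * (1 + y) * alpha ^ 2 = (1 - alpha ^ 2) * saha_factor Ti T.
Proof.
  intros HTi HT0 Ha0 HK Hc Ew0 HS0.
  assert (Hw0 : 0 < w0) by (rewrite Ew0; nra).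
  assert (Hk : 0 < K / w0) by now apply Rdiv_lt_0_compat.
  destruct (frozen_ionization_shock K w0 HK Hw0) as (ym & Hym & Eym).
  assert (Hc0 : 0 < c * alpha0 ^ 2) by (apply Rmult_lt_0_compat; nra).
  set (eps := Rpower (c * alpha0 ^ 2) (2 / 5)).
  assert (Heps : 0 < eps) by apply exp_pos.
  destruct (shock_w_small K w0 ym eps HK Hw0 Heps Hym)
    as (yl & [Hyl Hylm] & Hwl).
  set (al := shock_alpha K w0 Ti alpha0).
  set (T := fun y => shock_w K w0 y / (1 + al y)).
  assert (Eal : al ym = alpha0).
  { unfold al, shock_alpha. rewrite Eym. field. lra. }
  assert (Hal : forall y, K / w0 < y < ym -> alpha0 < al y).
  { intros y Hy. rewrite <- Eal. apply shock_alpha_decreasing; lra. }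
  assert (Hal' : forall y, K / w0 < y <= ym -> alpha0 <= al y).
  { intros y Hy. destruct (Req_dec y ym) as [-> | Hn]; [lra | ].
    left; apply Hal; lra. }
  assert (HT : forall y, K / w0 < y <= ym -> 0 < T y).
  { intros y Hy. pose proof (Hal' y Hy). apply Rdiv_lt_0_compat; [ | lra].
    unfold shock_w. apply Rmult_lt_0_compat; [lra | ].
    assert (K / y < w0); [ | lra].
    apply Rmult_lt_reg_r with (y / w0); [apply Rdiv_lt_0_compat; lra | ].
    replace (K / y * (y / w0)) with (K / w0) by (field; lra).
    replace (w0 * (y / w0)) with y by (field; lra). lra. }
  set (psi := fun y => (1 - al y ^ 2) * saha_factor Ti (T y)
                       - c * (1 + y) * al y ^ 2).
  assert (Hcont : forall y, yl <= y <= ym -> continuity_pt psi y).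
  { intros y Hy.
    assert (Hy0 : K / w0 < y <= ym) by lra.
    pose proof (Hal' y Hy0). pose proof (HT y Hy0).
    assert (Hca : continuity_pt al y).
    { unfold al, shock_alpha. reg. lra. }
    assert (HcT : continuity_pt T y).
    { apply continuity_pt_div.
      - unfold shock_w. reg. lra.
      - apply continuity_pt_plus; [reg | exact Hca].
      - lra. }
    assert (Hca2 : continuity_pt (fun z => al z ^ 2) y).
    { apply (continuity_pt_comp al (fun z => z ^ 2)); [exact Hca | reg]. }
    apply continuity_pt_minus.
    - apply continuity_pt_mult.
      + apply continuity_pt_minus; [reg | exact Hca2].
      + apply (continuity_pt_comp T (saha_factor Ti)); [exact HcT | ].
        now apply saha_factor_continuous.
    - apply continuity_pt_mult; [reg | exact Hca2]. }
  (* [eps] was chosen so that [S(T)] falls below [c * alpha0 ^ 2], a lower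
     bound for the left side of Saha's law. *)
  assert (Hleft : psi yl < 0).
  { unfold psi.
    assert (Hyl0 : K / w0 < yl < ym) by lra.
    pose proof (Hal yl Hyl0) as Hayl.
    assert (HTl : 0 < T yl) by (apply HT; lra).
    assert (HTe : T yl <= eps).
    { apply Rmult_le_reg_r with (1 + al yl); [lra | ].
      unfold T, Rdiv. rewrite Rmult_assoc, Rinv_l by lra. nra. }
    pose proof (saha_factor_small Ti (T yl) _ HTi Hc0 HTl HTe) as Hsm.
    pose proof (saha_factor_pos Ti (T yl)) as Hsp.
    assert (c * alpha0 ^ 2 < c * (1 + yl) * al yl ^ 2).
    { assert (alpha0 ^ 2 < al yl ^ 2) by nra.
      apply Rlt_trans with (c * al yl ^ 2).
      - apply Rmult_lt_compat_l; assumption.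
      - apply Rmult_lt_compat_r; nra. }
    assert (0 <= al yl ^ 2) by nra.
    nra. }
  assert (Hright : 0 < psi ym).
  { unfold psi. rewrite Eal.
    assert (ET : T ym = T0 * monatomic_jump (1 + ym)).
    { unfold T. rewrite Eal. unfold shock_w, monatomic_jump.
      (* With [alpha = alpha0] the equation for [ym] determines [K], and
         eliminating [K] from [w] leaves the monatomic ratio. *)
      assert (EK : K = 3 * w0 * ym ^ 2 / (4 * ym + 5)).
      { apply Rmult_eq_reg_r with ((4 * ym + 5) / ym).
        - replace (K * ((4 * ym + 5) / ym)) with (5 * K / ym + 4 * K)
            by (field; lra).
          replace (5 * K / ym + 4 * K) with (3 * w0 * ym) by lra.
          field. lra.
        - apply Rgt_not_eq, Rdiv_lt_0_compat; lra. }
      rewrite EK, Ew0. field. repeat split; lra. }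
    rewrite ET.
    assert (H1 : 1 < 1 + ym) by lra.
    pose proof (saha_compression Ti T0 (1 + ym) HTi HT0 H1) as Hc1.
    assert (0 < 1 - alpha0 ^ 2) by nra.
    replace (c * (1 + ym) * alpha0 ^ 2) with ((1 + ym) * (c * alpha0 ^ 2))
      by ring.
    rewrite HS0. nra. }
  destruct (IVT_interv psi yl ym Hcont Hylm Hleft Hright) as (y & Hy & Ey).
  assert (Hlt : y < ym).
  { destruct (Req_dec y ym) as [E | ]; [rewrite E in Ey | ]; lra. }
  assert (Ha : alpha0 < al y) by (apply Hal; lra).
  assert (HTy : 0 < T y) by (apply HT; lra).
  exists y, (al y), (T y).
  unfold psi in Ey.
  repeat split; try lra.
  - pose proof (saha_factor_pos Ti (T y)).
    assert (0 < c * (1 + y) * al y ^ 2)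
      by (repeat apply Rmult_lt_0_compat; lra).
    assert (0 < 1 - al y ^ 2) by nra.
    nra.
  - unfold T. field. lra.
Qed.

Theorem theorem5p1 (a Ti kappa : R)
  (ha : 0 < a ^ 2) (hTi : 0 < Ti) (hkappa : 0 < kappa)
  (alpha0 u0 T0 : R) (halpha0 : 0 < alpha0 < 1) (hT0 : 0 < T0)
  (u : R) (hu : u <> u0) :
  exists! x : R * R,
    alpha0 < fst x < 1 /\ 0 < snd x
    /\ hugoniot_locus a Ti kappa alpha0 u0 T0 (fst x) u (snd x).
Proof.
  set (K := (u - u0) ^ 2 / a ^ 2).
  assert (HK : 0 < K).
  { apply Rdiv_lt_0_compat; [ | assumption].
    rewrite <- Rsqr_pow2. apply Rsqr_pos_lt. lra. }
  set (w0 := (1 + alpha0) * T0).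
  assert (Hw0 : 0 < w0) by (unfold w0; nra).
  pose proof (pressure_pos Ti kappa alpha0 T0 hkappa halpha0) as Hp0.
  remember (pressure Ti kappa alpha0 T0) as p0 eqn:Ep0.
  assert (HS0 : kappa * p0 * alpha0 ^ 2
                = (1 - alpha0 ^ 2) * saha_factor Ti T0)
    by (apply pressure_eq_iff; [assumption | lra | now symmetry]).
  assert (Hc : 0 < kappa * p0) by now apply Rmult_lt_0_compat.
  (* Every admissible point of the locus lies on the curve, at a parameter
     [y > 0], and satisfies Saha's law there. *)
  assert (Hpar : forall alpha T,
    alpha0 < alpha < 1 /\ 0 < T
      /\ hugoniot_locus a Ti kappa alpha0 u0 T0 alpha u T ->
    exists y, 0 < y /\ alpha = shock_alpha K w0 Ti alpha0 y
      /\ (1 + alpha) * T = shock_w K w0 y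
      /\ kappa * p0 * (1 + y) * alpha ^ 2
         = (1 - alpha ^ 2) * saha_factor Ti T).
  { intros alpha T (Ha & HT & HH).
    assert (Hp : 0 < pressure Ti kappa alpha T)
      by (apply pressure_pos; lra).
    set (y := pressure Ti kappa alpha T / p0 - 1).
    assert (Ep : pressure Ti kappa alpha T = p0 * (1 + y))
      by (unfold y; field; lra).
    assert (Hy : 0 < 1 + y) by nra.
    assert (HS : kappa * p0 * (1 + y) * alpha ^ 2
                 = (1 - alpha ^ 2) * saha_factor Ti T).
    { rewrite (Rmult_assoc kappa). apply pressure_eq_iff; lra. }
    rewrite Ep0 in Hp0, Ep.
    apply (hugoniot_locus_normalized a Ti kappa alpha0 u0 T0 alpha u T y
             ha Hy Hp0 Ep) in HH.
    rewrite <- Ep0 in *.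
    destruct HH as [Hkin Hth].
    assert (Hypos : 0 < y).
    { apply (ionizing_jump_compressive Ti alpha0 T0 alpha T w0 K y);
        try assumption; try lra; try reflexivity.
      pose proof (saha_factor_pos Ti T0).
      pose proof (saha_factor_pos Ti T).
      assert (alpha0 ^ 2 < alpha ^ 2) by nra.
      assert (alpha ^ 2 < 1) by nra.
      assert (0 < alpha0 ^ 2) by nra.
      apply Rmult_lt_reg_l with (1 - alpha0 ^ 2); [lra | ].
      rewrite <- Rmult_assoc, <- HS0.
      apply Rlt_trans with (kappa * p0 * (1 + y) * alpha ^ 2).
      - replace (kappa * p0 * alpha0 ^ 2 * (1 + y))
          with (kappa * p0 * (1 + y) * alpha0 ^ 2) by ring.
        apply Rmult_lt_compat_l; nra.
      - rewrite HS. nra. }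
    exists y. split; [assumption | ].
    destruct (proj1 (shock_curve_iff K w0 Ti alpha0 ((1 + alpha) * T) alpha y
                hTi Hypos) (conj Hkin Hth)) as [E1 E2].
    auto. }
  destruct (saha_curve_exists Ti T0 alpha0 w0 K (kappa * p0))
    as (y & alpha & T & Hy & Ha & HT & Ea & Ew & ES);
    try assumption; try reflexivity.
  assert (HH : alpha0 < alpha < 1 /\ 0 < T
               /\ hugoniot_locus a Ti kappa alpha0 u0 T0 alpha u T).
  { split; [assumption | split; [assumption | ]].
    assert (Ep : pressure Ti kappa alpha T = p0 * (1 + y)).
    { apply pressure_eq_iff; lra. }
    rewrite Ep0 in Hp0, Ep.
    apply (hugoniot_locus_normalized a Ti kappa alpha0 u0 T0 alpha u T y);
      try assumption; try lra.
    apply (shock_curve_iff K w0 Ti alpha0 ((1 + alpha) * T) alpha y);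
      auto. }
  exists (alpha, T). split; [exact HH | ].
  intros [alpha' T'] HH'. cbn [fst snd] in HH'.
  destruct (Hpar alpha' T' HH') as (y' & Hy' & Ea' & Ew' & ES').
  destruct HH' as (Ha' & HT' & _).
  destruct (Rtotal_order y y') as [Hlt | [Heq | Hgt]].
  - exfalso.
    apply (saha_curve_unique Ti K w0 alpha0 (kappa * p0)
             y y' alpha alpha' T T'); try assumption; lra.
  - subst y'. rewrite <- Ea in Ea'. subst alpha'. f_equal.
    apply Rmult_eq_reg_l with (1 + alpha); lra.
  - exfalso.
    apply (saha_curve_unique Ti K w0 alpha0 (kappa * p0)
             y' y alpha' alpha T' T); try assumption; lra.
Qed.
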